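(* Let $F$ be the free group on $a_1,a_2,a_3,b_1,b_2,b_3$ and consider its subgroups $$H=\langle b_1b_2a_2b_2^{-1}b_1^{-1},\ a_1^2,\ a_1b_1b_3a_3(a_1b_1b_3)^{-1}\rangle,\qquad K=\langle b_1b_2a_2b_2^{-1}b_1^{-1},\ a_1^3,\ a_1b_1b_3a_3(a_1b_1b_3)^{-1}\rangle.$$ Then exactly one double coset $HtK$, $t\in F$, satisfies $H\cap tKt^{-1}\neq\{1\}$, namely $HK$ (so one can take $S(H,K)=\{1\}$), $$H\cap K=\langle b_1b_2a_2b_2^{-1}b_1^{-1},\ a_1^6,\ a_1b_1b_3a_3(a_1b_1b_3)^{-1}\rangle,$$ and the Stallings graph $Z$ of the join $\langle H,K\rangle$ is trivalent (every vertex has degree 3) but has a vertex of degree 3 none of whose preimages in the Stallings graphs $X$ of $H$ and $Y$ of $K$ has degree 3. In particular, the following assertion is false: for all finitely generated subgroups $H,K$ of a free group, if every vertex of the Stallings graph $Z$ of $\langle H,K\rangle$ has degree 3 or 2, then every vertex of $Z$ of degree 3 has a preimage of degree 3 in the Stallings graph $X$ of $H$ or $Y$ of $K$.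
   Context: $F=\pi_1(U)$, with $U$ the graph with one vertex and six oriented loops labeled $a_1,a_2,a_3,b_1,b_2,b_3$. The Stallings graph of a finitely generated subgroup $G\le F$ is the core of the covering of $U$ corresponding to $G$, where the core of a graph is the subgraph consisting of all edges lying on circuits (cyclically reduced closed paths of positive length), with their endpoints; it has a natural locally injective map to $U$. Since $H,K\le\langle H,K\rangle$, there are natural graph maps $X\to Z$ and $Y\to Z$ over $U$; preimages of vertices of $Z$ are taken with respect to these maps. $S(H,K)$ denotes a set of representatives of the double cosets $HtK$ with $H\cap tKt^{-1}\ne\{1\}$. *)

(* Defs.v *)
From HB Require Import structures.
From mathcomp Require Import all_boot.
From mathcomp Require Import boolp classical_sets cardinality.
From Stdlib Require List.

Set Implicit Arguments.
Unset Strict Implicit.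
Unset Printing Implicit Defensive.

Local Open Scope classical_set_scope.
Local Open Scope group_scope.

(** * Subgroups and double cosets of an arbitrary group *)

Section Subgroups.
Variable G : groupType.
Implicit Types (A : set G) (x y t : G).

Definition group_set A : Prop :=
  [/\ A 1, forall x y, A x -> A y -> A (x * y) & forall x, A x -> A x^-1].

Record subgroup := Subgroup {
  subgroup_set :> set G;
  subgroup_groupP : group_set subgroup_set
}.

Lemma smallest_group_set A : group_set (smallest group_set A).
Proof.
split=> [B [[]] //|x y xA yA B AB|x xA B AB]; have [[_ BM BV] _] := AB.
- by apply: BM; [exact: xA | exact: yA].
- by apply: BV; exact: xA.
Qed.

Definition generated A : subgroup := Subgroup (smallest_group_set A).

Definition join (H K : subgroup) : subgroup := generated (H `|` K).

Lemma join_subl (H K : subgroup) : H `<=` join H K.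
Proof. by move=> x Hx B [_]; apply; left. Qed.

Lemma join_subr (H K : subgroup) : K `<=` join H K.
Proof. by move=> x Kx B [_]; apply; right. Qed.

Definition finitely_generated (H : subgroup) : Prop :=
  exists2 A : set G, finite_set A & H = generated A :> set G.

Definition rcoset A x : set G := [set a * x | a in A].

Definition conjugate t A : set G := [set t * a * t^-1 | a in A].

Definition double_coset (H : subgroup) t (K : subgroup) : set G :=
  [set h * t * k | h in H & k in K].

Definition meets_conjugate (H K : subgroup) t : Prop :=
  H `&` conjugate t K <> [set 1].

(* [double_coset_reps H K T]: the set [T] is a possible choice of S(H,K). *)
Definition double_coset_reps (H K : subgroup) (T : set G) : Prop :=
  T `<=` [set t | meets_conjugate H K t] /\
  forall t, meets_conjugate H K t ->
    exists! s, T s /\ double_coset H s K = double_coset H t K.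

Lemma rcosetM A x y : rcoset (rcoset A x) y = rcoset A (x * y).
Proof.
apply/seteqP; split=> z /=.
- by move=> [_ [a Aa <-] <-]; exists a; rewrite // mulgA.
- by move=> [a Aa <-]; exists (a * x); [exists a | rewrite mulgA].
Qed.

Lemma rcoset1 A : rcoset A 1 = A.
Proof.
by apply/seteqP; split=> z /= => [[a Aa <-]|Az]; [|exists z]; rewrite ?mulg1.
Qed.

End Subgroups.

(** * The free group on a set [S], as the group of reduced words *)

Section FreeGroup.
Variable S : choiceType.

(* [(s, false)] stands for the generator [s] and [(s, true)] for its inverse. *)
Definition letter : Type := (S * bool)%type.

Implicit Types (x y : letter) (u v w : seq letter).

Definition inv_letter x : letter := (x.1, ~~ x.2).

Lemma inv_letterK : involutive inv_letter.
Proof. by case=> s b; rewrite /inv_letter /= negbK. Qed.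

Lemma inv_letter_neq x : inv_letter x != x.
Proof. by case: x => s b; rewrite xpair_eqE /=; case: b; rewrite andbF. Qed.

Definition reduced w : bool := sorted (fun x y => y != inv_letter x) w.

Definition push x w : seq letter :=
  if w is y :: w' then if y == inv_letter x then w' else x :: w else [:: x].

Definition reduce w : seq letter := foldr push [::] w.

Lemma reduced_push x w : reduced w -> reduced (push x w).
Proof.
case: w => [|y w] //= yw; case: eqP => [_|/eqP xy].
  exact: path_sorted yw.
by rewrite /reduced /= xy.
Qed.

Lemma reduced_foldr u w : reduced w -> reduced (foldr push w u).
Proof. by move=> rw; elim: u => //= x u; exact: reduced_push. Qed.

Lemma reduced_reduce w : reduced (reduce w).
Proof. exact: reduced_foldr. Qed.

Lemma reduce_id w : reduced w -> reduce w = w.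
Proof.
elim: w => //= x w IHw xw; rewrite IHw; last exact: path_sorted xw.
by case: w xw {IHw} => //= y w /andP[/negPf->].
Qed.

Lemma pushK x w : reduced w -> push (inv_letter x) (push x w) = w.
Proof.
case: w => [|y w] /=; first by rewrite inv_letterK eqxx.
case: eqP => [->|_ _] /=; last by rewrite inv_letterK eqxx.
by case: w => [|z w] //= /andP[/negPf->].
Qed.

Lemma foldr_push_push x u w : reduced w ->
  foldr push w (push x u) = push x (foldr push w u).
Proof.
move=> rw; case: u => [|y u] //=; case: eqP => // -> /=.
by rewrite -[X in push X (push _ _)]inv_letterK pushK // reduced_foldr.
Qed.

Lemma foldr_reduce u w : reduced w ->
  foldr push w (reduce u) = foldr push w u.
Proof. by move=> rw; elim: u => //= x u IHu; rewrite foldr_push_push ?IHu. Qed.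

Definition inv_word w : seq letter := rev (map inv_letter w).

Lemma inv_wordK : involutive inv_word.
Proof.
move=> w; rewrite /inv_word map_rev revK -map_comp map_id_in // => x _.
exact: inv_letterK.
Qed.

Lemma foldr_push_inv u w : reduced w ->
  foldr push (foldr push w u) (inv_word u) = w.
Proof.
move=> rw; elim: u => //= x u IHu.
by rewrite /inv_word /= rev_cons -cats1 foldr_cat /= pushK // reduced_foldr.
Qed.

Definition free : Type := {w : seq letter | reduced w}.

HB.instance Definition _ := Choice.on free.

Definition free_word w : free := Sub (reduce w) (reduced_reduce w).

Definition free_one : free := free_word [::].
Definition free_mul (f g : free) : free := free_word (val f ++ val g).
Definition free_inv (f : free) : free := free_word (inv_word (val f)).

Lemma free_mulE (f g : free) : val (free_mul f g) = foldr push (val g) (val f).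
Proof. by rewrite /= /reduce foldr_cat -/(reduce _) reduce_id ?(valP g). Qed.

Lemma free_mulA : associative free_mul.
Proof.
move=> f g h; apply: val_inj.
rewrite (free_mulE f) (free_mulE g) (free_mulE _ h).
by rewrite /= foldr_reduce ?(valP h) // foldr_cat.
Qed.

Lemma free_mul1 : left_id free_one free_mul.
Proof. by move=> f; apply: val_inj; rewrite free_mulE. Qed.

Lemma free_mulr1 : right_id free_one free_mul.
Proof.
by move=> f; apply: val_inj; rewrite free_mulE -/(reduce _) reduce_id ?(valP f).
Qed.

Lemma free_mulV : left_inverse free_one free_inv free_mul.
Proof.
move=> f; apply: val_inj; rewrite free_mulE /= foldr_reduce ?(valP f) //.
by rewrite -{1}(reduce_id (valP f)) foldr_push_inv.
Qed.

Lemma free_mulrV : right_inverse free_one free_inv free_mul.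
Proof.
move=> f; apply: val_inj; rewrite free_mulE /=.
rewrite -{2}(inv_wordK (val f)).
exact: (@foldr_push_inv (inv_word (val f)) [::]).
Qed.

HB.instance Definition _ := isGroup.Build free
  free_mulA free_mul1 free_mulr1 free_mulV free_mulrV.

Definition free_gen (s : S) : free := free_word [:: (s, false)].

Definition letter_val x : free := if x.2 then (free_gen x.1)^-1 else free_gen x.1.

Lemma letter_valV x : letter_val (inv_letter x) = (letter_val x)^-1.
Proof. by case: x => s [] //=; rewrite /letter_val /= invgK. Qed.

End FreeGroup.

(** * Graphs (in the sense of Serre) and their cores *)

(* An element of [edge] is an oriented edge; an unoriented edge is a pair
   [{e, rev_edge e}], so that a loop contributes 2 to the degree. *)
Record graph := Graph {
  vertex : Type;
  edge : Type;
  src : edge -> vertex;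
  rev_edge : edge -> edge;
  rev_edgeK : involutive rev_edge;
  rev_edge_neq : forall e, rev_edge e <> e
}.

Definition tgt (X : graph) (e : edge X) : vertex X := src (rev_edge e).

Definition degree_is (X : graph) (v : vertex X) (n : nat) : Prop :=
  ([set e : edge X | src e = v] #= `I_n)%card.

(* Consecutive edges of a reduced path. *)
Definition follows (X : graph) (e e' : edge X) : Prop :=
  src e' = tgt e /\ e' <> rev_edge e.

Definition circuit (X : graph) (p : seq (edge X)) : Prop :=
  p <> [::] /\ cycle (fun e e' => `[< follows e e' >]) p.

Definition core_edge (X : graph) (e : edge X) : Prop :=
  exists2 p, circuit p & List.In e p \/ List.In (rev_edge e) p.

(* As [core_edge] is stable under [rev_edge], every endpoint of an edge of the
   core is the source of such an edge. *)
Definition core_vertex (X : graph) (v : vertex X) : Prop :=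
  exists2 e, core_edge e & src e = v.

Section Core.
Variable X : graph.

Lemma core_edge_rev (e : edge X) : core_edge e -> core_edge (rev_edge e).
Proof. by move=> [p cp ep]; exists p; rewrite // rev_edgeK; tauto. Qed.

Lemma core_edge_src (e : edge X) : core_edge e -> core_vertex (src e).
Proof. by exists e. Qed.

Definition core_rev (e : {e : edge X | core_edge e}) : {e : edge X | core_edge e} :=
  exist _ (rev_edge (sval e)) (core_edge_rev (svalP e)).

Lemma core_revK : involutive core_rev.
Proof. by move=> [e ce]; apply: eq_exist; exact: rev_edgeK. Qed.

Lemma core_rev_neq e : core_rev e <> e.
Proof. by move=> /(congr1 sval); exact: rev_edge_neq. Qed.

Definition core : graph := @Graph
  {v : vertex X | core_vertex v} {e : edge X | core_edge e}
  (fun e => exist _ (src (sval e)) (core_edge_src (svalP e)))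
  core_rev core_revK core_rev_neq.

End Core.

Record graph_map (X Y : graph) := GraphMap {
  vmap : vertex X -> vertex Y;
  emap : edge X -> edge Y;
  graph_map_src : forall e, src (emap e) = vmap (src e);
  graph_map_rev : forall e, emap (rev_edge e) = rev_edge (emap e)
}.

Definition locally_injective (X Y : graph) (f : graph_map X Y) : Prop :=
  forall e e', src e = src e' -> emap f e = emap f e' -> e = e'.

(* A locally injective map sends circuits to circuits, hence restricts to the
   cores. *)
Section CoreMap.
Variables (X Y : graph) (f : graph_map X Y) (f_inj : locally_injective f).

Lemma follows_map e e' : follows e e' -> follows (emap f e) (emap f e').
Proof.
move=> [see' ee']; split; first by rewrite /tgt -graph_map_rev !graph_map_src see'.
by rewrite -graph_map_rev => /f_inj-/(_ see').
Qed.

Lemma circuit_map p : circuit p -> circuit (map (emap f) p).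
Proof.
move=> [p0 cp]; split; first by case: p p0 {cp}.
case: p {p0} cp => //= e p; rewrite -map_rcons path_map.
by apply: sub_path => {}e e' /asboolP ee'; apply/asboolP; exact: follows_map.
Qed.

Lemma core_edge_map e : core_edge e -> core_edge (emap f e).
Proof.
move=> [p cp ep]; exists (map (emap f) p); first exact: circuit_map.
by rewrite -graph_map_rev; case: ep => ep; [left|right]; exact: List.in_map.
Qed.

Lemma core_vertex_map v : core_vertex v -> core_vertex (vmap f v).
Proof.
move=> [e ce <-]; exists (emap f e); first exact: core_edge_map.
exact: graph_map_src.
Qed.

Definition core_vmap (v : vertex (core X)) : vertex (core Y) :=
  exist _ (vmap f (sval v)) (core_vertex_map (svalP v)).

Definition core_emap (e : edge (core X)) : edge (core Y) :=
  exist _ (emap f (sval e)) (core_edge_map (svalP e)).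

Lemma core_map_src e : src (core_emap e) = core_vmap (src e).
Proof. by apply: eq_exist; exact: graph_map_src. Qed.

Lemma core_map_rev e : core_emap (rev_edge e) = rev_edge (core_emap e).
Proof. by apply: eq_exist; exact: graph_map_rev. Qed.

Definition core_map : graph_map (core X) (core Y) :=
  GraphMap core_map_src core_map_rev.

End CoreMap.

(** * Coverings of the rose and Stallings graphs *)

Section Covering.
Variable S : choiceType.
Implicit Types (G H Z : subgroup (free S)) (x : letter S).

Lemma rose_rev_neq (x : letter S) : inv_letter x <> x.
Proof. exact/eqP/inv_letter_neq. Qed.

(* The graph with one vertex and an oriented loop for each element of [S]. *)
Definition rose : graph := @Graph unit (letter S) (fun=> tt) (@inv_letter S)
  (@inv_letterK S) rose_rev_neq.

(* The covering of the rose with fundamental group [G] has the right cosets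
   [G w] as vertices; the lift of the edge [x] starting at [G w] ends at
   [G w x]. *)
Definition coset_vertex G : Type :=
  {C : set (free S) | exists w, C = rcoset G w}.

Lemma coset_step_subproof G (C : coset_vertex G) x :
  exists w, rcoset (sval C) (letter_val x) = rcoset G w.
Proof.
by case: C => _ /= [w ->]; exists (w * letter_val x); rewrite rcosetM.
Qed.

Definition coset_step G (C : coset_vertex G) x : coset_vertex G :=
  exist _ (rcoset (sval C) (letter_val x)) (coset_step_subproof C x).

Definition cover_rev G (e : coset_vertex G * letter S) :=
  (coset_step e.1 e.2, inv_letter e.2).

Lemma cover_revK G : involutive (@cover_rev G).
Proof.
move=> [C x]; rewrite /cover_rev /= inv_letterK; congr pair.
case: C => C CP; apply: eq_exist.
by rewrite /= rcosetM letter_valV mulgV rcoset1.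
Qed.

Lemma cover_rev_neq G (e : coset_vertex G * letter S) : cover_rev e <> e.
Proof. by move=> /(congr1 snd); exact: rose_rev_neq. Qed.

Definition cover G : graph :=
  @Graph (coset_vertex G) (coset_vertex G * letter S) fst
    (@cover_rev G) (@cover_revK G) (@cover_rev_neq G).

Definition cover_label G : graph_map (cover G) rose :=
  @GraphMap (cover G) rose (fun=> tt) snd (fun=> erefl) (fun=> erefl).

(* For H <= Z, the map of coverings [cover H -> cover Z] sends [H w] to [Z w],
   which is also the product set [Z (H w)]. *)
Section CoverMap.
Variables (H Z : subgroup (free S)) (HZ : H `<=` Z).

Definition coset_prod (C : set (free S)) : set (free S) :=
  [set z * c | z in Z & c in C].

Lemma coset_prod_rcoset w : coset_prod (rcoset H w) = rcoset Z w.
Proof.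
have [[H1 _ _] [_ ZM _]] := (subgroup_groupP H, subgroup_groupP Z).
apply/seteqP; split=> y /=.
- move=> [z Zz [_ [h Hh <-] <-]]; exists (z * h); last by rewrite mulgA.
  by apply: ZM => //; exact: HZ.
- by move=> [z Zz <-]; exists z => //; exists w => //; exists 1; rewrite ?mul1g.
Qed.

Lemma cover_vmap_subproof (C : coset_vertex H) :
  exists w, coset_prod (sval C) = rcoset Z w.
Proof. by case: C => _ /= [w ->]; exists w; rewrite coset_prod_rcoset. Qed.

Definition cover_vmap (C : vertex (cover H)) : vertex (cover Z) :=
  exist _ (coset_prod (sval C)) (cover_vmap_subproof C).

Definition cover_emap (e : edge (cover H)) : edge (cover Z) :=
  (cover_vmap e.1, e.2).

Lemma cover_map_rev e : cover_emap (rev_edge e) = rev_edge (cover_emap e).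
Proof.
case: e => [[C [w Cw]] x]; congr pair; apply: eq_exist.
by rewrite /= Cw rcosetM !coset_prod_rcoset rcosetM.
Qed.

Definition cover_map : graph_map (cover H) (cover Z) :=
  @GraphMap (cover H) (cover Z) cover_vmap cover_emap (fun=> erefl) cover_map_rev.

Lemma cover_map_label e : emap (cover_label Z) (emap cover_map e) =
  emap (cover_label H) e.
Proof. by []. Qed.

Lemma cover_map_inj : locally_injective cover_map.
Proof. by move=> [C x] [D y] /= -> [->]. Qed.

End CoverMap.

Definition stallings G : graph := core (cover G).

Definition stallings_map H Z (HZ : H `<=` Z) :
    graph_map (stallings H) (stallings Z) :=
  core_map (@cover_map_inj H Z HZ).

Definition to_joinl H K : graph_map (stallings H) (stallings (join H K)) :=
  stallings_map (@join_subl _ H K).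

Definition to_joinr H K : graph_map (stallings K) (stallings (join H K)) :=
  stallings_map (@join_subr _ H K).

End Covering.

(** * The free group on [a1, a2, a3, b1, b2, b3] *)

Variant generator := A1 | A2 | A3 | B1 | B2 | B3.

Definition generator_rank (g : generator) : nat :=
  match g with A1 => 0 | A2 => 1 | A3 => 2 | B1 => 3 | B2 => 4 | B3 => 5 end.

Definition generator_unrank (n : nat) : generator :=
  nth A1 [:: A1; A2; A3; B1; B2; B3] n.

Lemma generator_rankK : cancel generator_rank generator_unrank.
Proof. by case. Qed.

HB.instance Definition _ := Countable.copy generator (can_type generator_rankK).

Definition a1 : free generator := free_gen A1.
Definition a2 : free generator := free_gen A2.
Definition a3 : free generator := free_gen A3.
Definition b1 : free generator := free_gen B1.
Definition b2 : free generator := free_gen B2.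
Definition b3 : free generator := free_gen B3.

(* Main.v *)
Require Import Defs.
From mathcomp Require Import all_boot finmap.
From mathcomp Require Import boolp classical_sets cardinality.

Set Implicit Arguments.
Unset Strict Implicit.
Unset Printing Implicit Defensive.

Local Open Scope classical_set_scope.
Local Open Scope group_scope.

(** Both subgroups are the n = 2 and n = 3 cases of one family, whose Stallings
graph is an oriented n-cycle of edges a1 with two lassos: one leaves the base
vertex along b1, runs along b2 and ends in a loop a2; the other leaves the next
vertex of the cycle along b1, runs along b3 and ends in a loop a3. A subgroup is
handled through a finite folded labelled graph of which it is the stabilizer of
the base vertex; a finite folded graph is recognized as the right one by a
spanning tree, since every arc outside the tree must give one of the proposed
generators ([spanning_generates]).

For n = 2 and 3 the fiber product of the graphs has a single connected component
with an arc: a 6-cycle, the two lassos based at (0, 0) and (1, 1), and two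
dangling arcs b1. As the fiber product presents the intersection
([stabilizer_product]), this gives the generators of the intersection. For the
double cosets, let k = c l c^-1 be a nontrivial element of K with l cyclically
reduced and t k t^-1 in H. Then l is read along closed paths of both graphs,
starting at the vertices K c and H t c ([act_loop]); this pair of vertices lies
on an arc of the fiber product, hence is reached from the base pair by one
word r, so that K c = K r and H t c = H r, and t lies in H K
([meets_conjugate_factor]).

In the join the cycle shrinks to a loop a1, and the two arcs b1, with distinct
ends in X and in Y, become one arc, whose end z has degree 3: one arc arrives
along b1 and two leave along b2 and b3. Its preimages keep only one of the
outgoing arcs each, so they have degree 2.

To pass from the finite graphs to the cores of the coverings, the covering is
described as the finite graph with infinite trees attached: its vertices are
pairs of a vertex of the finite graph and a reduced word not readable there. A
reduced path that has entered a tree can only go deeper, so circuits stay in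
the finite graph ([act_loop], [core_edge_step]). *)

(** * Folded labelled graphs and the trees attached to them *)
Section LabelledGraphs.
Variables (S : choiceType) (Q : eqType).
Implicit Types (x y : letter S) (w l s : seq (letter S)) (q : Q).
Implicit Types (c : Q * seq (letter S)) (E : seq (Q * S * Q)).

(** A labelled graph is the list of its positively oriented arcs, given as
(source, label, target). *)
Definition arc E q x q' : bool :=
  if x.2 then (q', x.1, q) \in E else (q, x.1, q') \in E.

Definition targets E q x : seq Q :=
  if x.2 then [seq e.1.1 | e <- E & (e.1.2, e.2) == (x.1, q)]
  else [seq e.2 | e <- E & e.1 == (q, x.1)].

Definition step E q x : option Q := ohead (targets E q x).

(** The labelling is an immersion into the rose, in a form decided by computation. *)
Definition folded E : bool :=
  all2rel (fun e f => (e.1 == f.1) || ((e.1.2, e.2) == (f.1.2, f.2)) ==>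
                      (e == f)) E.

Lemma mem_targets E q x q' : (q' \in targets E q x) = arc E q x q'.
Proof.
rewrite /targets /arc; case: x => s [] /=; apply/mapP/idP.
- by case=> [[[p r] p']]; rewrite mem_filter /= => /andP[/eqP[-> ->] ?] ->.
- by exists (q', s, q); rewrite // mem_filter /= eqxx.
- by case=> [[[p r] p']]; rewrite mem_filter /= => /andP[/eqP[-> ->] ?] ->.
- by exists (q, s, q'); rewrite // mem_filter /= eqxx.
Qed.

Lemma arcV E q x q' : arc E q' (inv_letter x) q = arc E q x q'.
Proof. by case: x => s []. Qed.

Lemma arc_fun E q x q1 q2 : folded E ->
  arc E q x q1 -> arc E q x q2 -> q1 = q2.
Proof.
move=> /allrelP fE; rewrite /arc; case: x => s [] /= e1 e2.
- by have /= := fE _ _ e1 e2; rewrite eqxx orbT /= => /eqP[].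
- by have /= := fE _ _ e1 e2; rewrite eqxx /= => /eqP[].
Qed.

Lemma stepP E q x q' : folded E -> reflect (step E q x = Some q') (arc E q x q').
Proof.
move=> fE; have stepA q1 : step E q x = Some q1 -> arc E q x q1.
  rewrite -mem_targets /step; case: targets => //= q2 t [->].
  by rewrite mem_head.
apply: (iffP idP) => [qq'|/stepA //].
case E1: (step E q x) => [q1|]; first by congr Some; apply: arc_fun (stepA _ E1) qq'.
by move: E1 qq'; rewrite -mem_targets /step; case: targets.
Qed.

Lemma stepV E q x q' : folded E ->
  step E q x = Some q' -> step E q' (inv_letter x) = Some q.
Proof. by move=> fE /(stepP _ _ _ fE) qq'; apply/stepP; rewrite // arcV. Qed.

(** The covering of the rose that extends a folded graph: the state (q, s) is the
vertex at the end of the path that leaves the graph at q and reads s backwards,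
the head of s being the last letter read. *)
Definition move E c x : Q * seq (letter S) :=
  if (c.2, step E c.1 x) is ([::], Some q) then (q, [::])
  else (c.1, push x c.2).

Definition act E : Q * seq (letter S) -> seq (letter S) -> Q * seq (letter S) :=
  foldl (move E).

(** A path attached at q must be reduced, and its first letter, at the bottom of
the stack, must not be readable at q. *)
Definition proper_state E c : bool :=
  reduced c.2 && (if c.2 is y :: s then step E c.1 (last y s) == None else true).

Lemma moveK E c x : folded E -> proper_state E c ->
  move E (move E c x) (inv_letter x) = c.
Proof.
move=> fE; case: c => q [|y s] /andP[/= red bot]; rewrite /move /=.
  case: (step E q x) (@stepV E q x) => [q' /(_ q' fE erefl)->|_] //=.
  by rewrite inv_letterK eqxx.
case: eqP => [yx|xy] /=; last by rewrite inv_letterK eqxx.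
case: s red bot => [|z s] /=; first by rewrite yx => _ /eqP->.
by rewrite yx => /andP[/negPf-> _].
Qed.

Lemma proper_move E c x : folded E -> proper_state E c ->
  proper_state E (move E c x).
Proof.
move=> fE; case: c => q [|y s] /andP[/= red bot]; rewrite /move /=.
  by case Ex: (step E q x) => [q'|] //=; rewrite /proper_state /= Ex.
case: eqP => [yx|/eqP xy] /=; last by rewrite /proper_state /= bot andbT /reduced /= xy.
by case: s red bot => [|z s] //=; rewrite /proper_state /= => /andP[_ ->].
Qed.

Lemma proper_act E c w : folded E -> proper_state E c -> proper_state E (act E c w).
Proof. by move=> fE; elim: w c => //= x w IHw c wc; apply/IHw/proper_move. Qed.

Lemma act_push E c x w : folded E -> proper_state E c ->
  act E c (push x w) = act E (move E c x) w.
Proof.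
by move=> fE wc; case: w => [|y w] //=; case: eqP => [->|] //=; rewrite moveK.
Qed.

(** Letters act on proper states by permutations, inverse letters by inverse
permutations; hence the free group acts. *)
Lemma act_reduce E c w : folded E -> proper_state E c ->
  act E c (reduce w) = act E c w.
Proof.
move=> fE; elim: w c => //= x w IHw c wc.
by rewrite act_push // IHw // proper_move.
Qed.

Lemma act_inv E c w : folded E -> proper_state E c ->
  act E (act E c w) (inv_word w) = c.
Proof.
move=> fE; elim: w c => //= x w IHw c wc.
rewrite /inv_word /= rev_cons -cats1 /act foldl_cat -!/(act _ _ _) IHw ?proper_move //=.
exact: moveK.
Qed.

(** No letter cancels its predecessor, so a path inside an attached tree never comes
back. *)
Lemma act_grow E q y s l : path (fun x y => y != inv_letter x) y l ->
  act E (q, y :: s) l = (q, catrev l (y :: s)).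
Proof.
elim: l y s => //= x l IHl y s /andP[xy xl].
rewrite /move /= ifN; first exact: IHl.
by apply: contra xy => /eqP->; rewrite inv_letterK.
Qed.

Lemma act_step E q x q' w : step E q x = Some q' ->
  act E (q, [::]) (x :: w) = act E (q', [::]) w.
Proof. by rewrite /= /move /= => ->. Qed.

(** After a letter that is not readable, [act_grow] keeps the stack nonempty. *)
Lemma act_readable E q x w q' : reduced (x :: w) ->
  act E (q, [::]) (x :: w) = (q', [::]) ->
  exists2 q1, step E q x = Some q1 & act E (q1, [::]) w = (q', [::]).
Proof.
move=> red /=; rewrite /move /=; case: (step E q x) => [q1|]; first by exists q1.
rewrite act_grow // => -[_] /(congr1 size).
by rewrite catrevE size_cat size_rev addnS.
Qed.

Definition cyclically_reduced l : bool := cycle (fun x y => y != inv_letter x) l.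

(** A cyclically reduced loop based inside an attached tree at depth > 0 would
grow the stack, either itself or after inversion: its first letter and the
inverse of its last letter differ, so they do not both cancel the top letter. *)
Lemma act_loop E c x l : folded E -> proper_state E c ->
    cyclically_reduced (x :: l) ->
  act E c (x :: l) = c -> c.2 = [::] /\ step E c.1 x <> None.
Proof.
move=> fE wc cyc loop.
have grow q y s k : path (fun x y => y != inv_letter x) y k -> k <> [::] ->
    act E (q, y :: s) k <> (q, y :: s).
  move=> yk k0; rewrite act_grow // => -[] /(congr1 size) /eqP.
  rewrite catrevE size_cat size_rev -[X in _ == X]add0n eqn_add2r size_eq0.
  by move/eqP.
have xl : path (fun x y => y != inv_letter x) x l.
  by move: cyc; rewrite /cyclically_reduced /= rcons_path => /andP[].
case: c wc loop => q [|y s] wc loop; last first.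
  (* The loop itself grows unless x pops y; then the inverse loop grows. *)
  exfalso; have [yx|xy] := eqVneq x (inv_letter y); last first.
    by apply: (grow q y s (x :: l)) loop; rewrite //= xy.
  have yx' : y = inv_letter x by rewrite yx inv_letterK.
  have := act_inv (x :: l) fE wc; rewrite loop.
  apply: grow; last by rewrite /inv_word /= rev_cons; case: rev.
  have -> : inv_word (x :: l) = rev (belast y (map (@inv_letter S) (rcons l x))).
    by rewrite map_rcons belast_rcons /inv_word /= yx'.
  have ym : last y (map (@inv_letter S) (rcons l x)) = y.
    by rewrite map_rcons last_rcons.
  rewrite -{1}ym rev_path {1}yx' path_map; apply: sub_path cyc => u v /=.
  by apply: contra => /eqP/(can_inj (@inv_letterK S))->; rewrite inv_letterK.
split=> // /= Nx; move: loop => /=; rewrite /move /= Nx act_grow //.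
by move=> [] /(congr1 size); rewrite catrevE size_cat addnS.
Qed.

End LabelledGraphs.

(** * Words and elements of the free group *)
Section FreeWords.
Variable S : choiceType.
Implicit Types (x : letter S) (u v w : seq (letter S)) (g : free S).

Lemma free_wordK g : free_word (val g) = g.
Proof. by apply: val_inj; rewrite /= reduce_id ?(valP g). Qed.

Lemma free_word_cat u v : free_word (u ++ v) = free_word u * free_word v.
Proof.
apply: val_inj; rewrite /= /reduce !foldr_cat foldr_reduce ?reduced_foldr //.
by rewrite -!/(reduce _) (reduce_id (reduced_reduce v)).
Qed.

Lemma free_word_eq1 w : reduce w = [::] -> free_word w = 1 :> free S.
Proof. by move=> w1; apply: val_inj. Qed.

Lemma free_word_inv w : free_word (inv_word w) = (free_word w)^-1.
Proof.
have VM : free_word (inv_word w) * free_word w = 1.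
  rewrite -free_word_cat; apply: free_word_eq1.
  by rewrite /reduce foldr_cat foldr_push_inv.
by rewrite -[LHS](mulgK (free_word w)) VM mul1g.
Qed.

Lemma letter_valE x : letter_val x = free_word [:: x].
Proof. by case: x => s [] //; rewrite -free_word_inv. Qed.

Lemma cyclic_reduction w : reduced w -> w <> [::] ->
  exists2 l, l <> [::] /\ cyclically_reduced l & exists c, w = c ++ l ++ inv_word c.
Proof.
have [n] := ubnP (size w); elim: n w => // n IHn [_ _ []|x w] // /ltnSE wn red _.
have [last_x|last_x] := eqVneq x (inv_letter (last x w)); last first.
  exists (x :: w); last by exists [::]; rewrite cats0.
  by split=> //; rewrite /cyclically_reduced /= rcons_path; apply/andP.
have last_x' : last x w = inv_letter x by rewrite [in RHS]last_x inv_letterK.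
case/lastP: w wn red last_x last_x' => [|w y] wn red last_x last_x'.
  by move: (inv_letter_neq x); rewrite -last_x' eqxx.
rewrite last_rcons in last_x'; rewrite {}last_x' in wn red *.
move: red; rewrite /reduced /= rcons_path => /andP[xw wx].
have rw : reduced w by apply: path_sorted xw.
have [||l lP [c ->]] := IHn _ _ rw.
- by move: wn; rewrite /= size_rcons; apply: leq_trans.
- by case: w wx {last_x wn xw rw} => //=; rewrite eqxx.
exists l => //; exists (x :: c).
by rewrite /inv_word /= rev_cons -!cats1 /= -!catA.
Qed.

End FreeWords.

Lemma generated_sub (G : groupType) (A : set G) (H : subgroup G) :
  A `<=` H -> generated A `<=` H.
Proof. by move=> AH; apply: smallest_sub => //; exact: subgroup_groupP. Qed.

Lemma sub_generated (G : groupType) (A : set G) : A `<=` generated A.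
Proof. by apply: sub_smallest. Qed.

(** * Generators of a stabilizer from a spanning tree *)
Section Recognition.
Variables (S : choiceType) (Q : eqType).
Implicit Types (x y : letter S) (w l s : seq (letter S)) (q : Q) (g h : free S).
Implicit Types (c : Q * seq (letter S)) (E : seq (Q * S * Q)).
Implicit Types (G : set (free S)) (T B : seq (seq (letter S))).

Definition stabilizer E q0 : set (free S) :=
  [set g | act E (q0, [::]) (val g) = (q0, [::])].

Lemma act_mul E c g h : folded E -> proper_state E c ->
  act E c (val (g * h)) = act E (act E c (val g)) (val h).
Proof. by move=> fE wc; rewrite /= act_reduce // /act foldl_cat. Qed.

Lemma act_free_inv E c g : folded E -> proper_state E c ->
  act E (act E c (val g)) (val g^-1) = c.
Proof. by move=> fE wc; rewrite /= act_reduce ?act_inv ?proper_act. Qed.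

Lemma stabilizer_group_set E q0 : folded E -> group_set (stabilizer E q0).
Proof.
move=> fE; split=> [|g h gG hG|g gG] //; rewrite /stabilizer /=.
  by rewrite -/(val (g * h)) act_mul // gG.
by rewrite -{1}gG; exact: act_free_inv.
Qed.

(** T lists the words read from q0 along a tree; the representative of q is the
first word of T that leads to q. *)
Definition rep E q0 T q : seq (letter S) :=
  nth [::] T (find (fun w => act E (q0, [::]) w == (q, [::])) T).

Definition reached E q0 T q : bool :=
  has (fun w => act E (q0, [::]) w == (q, [::])) T.

(** Besides the obvious conditions, each arc closed up along the tree represents
the trivial element or an element of the list B of generators. *)
Definition spanning E q0 T B : bool :=
  [&& folded E, rep E q0 T q0 == [::],
      all (fun w => act E (q0, [::]) w == (q0, [::])) B &
      all (fun e => [&& reached E q0 T e.1.1, reached E q0 T e.2 &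
        reduce (rep E q0 T e.1.1 ++ (e.1.2, false) :: inv_word (rep E q0 T e.2))
          \in [::] :: B]) E].

Lemma act_rep E q0 T q : reached E q0 T q ->
  act E (q0, [::]) (rep E q0 T q) = (q, [::]).
Proof. by move=> r; apply/eqP; have := nth_find [::] r. Qed.

Lemma reached_step E q0 T B q x q' : spanning E q0 T B ->
  step E q x = Some q' -> reached E q0 T q.
Proof.
case/and4P=> fE _ _ /allP sE /(stepP _ _ _ fE).
by rewrite /arc; case: x => s [] /sE/and3P[].
Qed.

Definition word_group B : subgroup (free S) :=
  generated [set free_word w | w in [set` B]].

(** The path of a word from q to q' splits as the product of the elements
r(p) x r(p')^-1 over its arcs p -x-> p', up to the end factors r(q) and r(q'),
where r is the chosen representative. *)
Lemma spanning_generates E q0 T B : spanning E q0 T B ->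
  word_group B = stabilizer E q0 :> set (free S).
Proof.
move=> /and4P[fE /eqP r0 /allP BE /allP sE]; set r := rep E q0 T in r0 sE.
apply/seteqP; split.
  apply: (@generated_sub _ _ (Subgroup (stabilizer_group_set q0 fE))).
  by move=> _ [w /BE/eqP wB <-] /=; rewrite /stabilizer /= act_reduce.
have [G1 GM GV] := subgroup_groupP (word_group B).
set G := subgroup_set (word_group B) in G1 GM GV *.
(* Negative letters follow by inversion, so only listed arcs need checking. *)
have posE e : e \in E ->
    G (free_word (r e.1.1) * free_word [:: (e.1.2, false)] * (free_word (r e.2))^-1).
  case/sE/and3P=> _ _; rewrite -free_word_inv -!free_word_cat -catA /=.
  rewrite inE => /orP[/eqP/free_word_eq1-> //|eB].
  apply: sub_generated.
  exists (reduce (r e.1.1 ++ (e.1.2, false) :: inv_word (r e.2))) => //.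
  exact: (free_wordK (free_word _)).
have stepE q x q' : step E q x = Some q' ->
    G (free_word (r q) * free_word [:: x] * (free_word (r q'))^-1).
  move/(stepP _ _ _ fE); rewrite /arc; case: x => s [] /= /posE //= /GV.
  by rewrite !invgM invgK mulgA -free_word_inv.
have walkE w q q' : reduced w -> act E (q, [::]) w = (q', [::]) ->
    G (free_word (r q) * free_word w * (free_word (r q'))^-1).
  elim: w q => [|x w IHw] q red; first by case=> ->; rewrite mulg1 mulgV.
  case/(act_readable red) => q1 /stepE Gx /(IHw _ (path_sorted red)) Gw.
  have := GM _ _ Gx Gw; rewrite !mulgA mulgVK.
  by rewrite -(mulgA _ (free_word [:: x])) -(free_word_cat [:: x]).
move=> g gE; have := walkE _ _ _ (valP g) gE.
by rewrite r0 free_wordK (_ : free_word [::] = 1) // invg1 mulg1 mul1g.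
Qed.

End Recognition.

(** * Fiber products and intersections *)
Section Product.
Variables (S : choiceType) (Q1 Q2 : eqType).
Variables (E1 : seq (Q1 * S * Q1)) (E2 : seq (Q2 * S * Q2)).
Hypotheses (fE1 : folded E1) (fE2 : folded E2).
Implicit Types (x : letter S) (w : seq (letter S)).

Definition fiber_product : seq ((Q1 * Q2) * S * (Q1 * Q2)) :=
  [seq ((e.1.1, f.1.1), e.1.2, (e.2, f.2)) |
     e <- E1, f <- [seq f <- E2 | f.1.2 == e.1.2]].

Lemma arc_product p x p' :
  arc fiber_product p x p' = arc E1 p.1 x p'.1 && arc E2 p.2 x p'.2.
Proof.
have mem q s q' : ((q, s, q') \in fiber_product) =
    ((q.1, s, q'.1) \in E1) && ((q.2, s, q'.2) \in E2).
  case: q q' => i j [i' j'] /=; apply/allpairsPdep/andP.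
    case=> -[[i1 s1] i1'] [[[j1 s2] j1']] /= [e].
    by rewrite mem_filter /= => /andP[/eqP-> f] [-> -> -> -> ->].
  case=> e f; exists (i, s, i'), (j, s, j').
  by split=> //; rewrite mem_filter /= eqxx.
by rewrite /arc; case: x.2; rewrite mem.
Qed.

Lemma folded_product : folded fiber_product.
Proof.
apply/allrelP=> -[[p s] p'] [[q t] q'] /= e f.
have /= := arc_product p (s, false) p'; rewrite {1}/arc /= e => /esym/andP[e1 e2].
have /= := arc_product q (t, false) q'; rewrite {1}/arc /= f => /esym/andP[f1 f2].
apply/implyP=> /orP[] /eqP[].
  move=> pq st; subst; case: p' q' e1 e2 f1 f2 {e f} => i j [i' j'] /= e1 e2 f1 f2.
  by rewrite (arc_fun fE1 e1 f1) (arc_fun fE2 e2 f2).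
move=> st pq; subst; case: p q e1 e2 f1 f2 {e f} => i j [i' j'] /= e1 e2 f1 f2.
rewrite -arcV in e1; rewrite -arcV in e2; rewrite -arcV in f1; rewrite -arcV in f2.
by rewrite (arc_fun fE1 e1 f1) (arc_fun fE2 e2 f2).
Qed.

Lemma step_product i j x i' j' : step fiber_product (i, j) x = Some (i', j') <->
  step E1 i x = Some i' /\ step E2 j x = Some j'.
Proof.
split=> [/(stepP _ _ _ folded_product)|[/(stepP _ _ _ fE1) e /(stepP _ _ _ fE2) f]].
  by rewrite arc_product => /andP[/(stepP _ _ _ fE1) ? /(stepP _ _ _ fE2)].
by apply/(stepP _ _ _ folded_product); rewrite arc_product e.
Qed.

(** A letter that is readable in one factor only makes the product leave its graph
while that factor stays inside; reducedness rules out a later return. *)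
Lemma act_product i j w i' j' : reduced w ->
  act fiber_product ((i, j), [::]) w = ((i', j'), [::]) <->
  act E1 (i, [::]) w = (i', [::]) /\ act E2 (j, [::]) w = (j', [::]).
Proof.
elim: w i j => [|x w IHw] i j red; first by split=> [[-> ->]|[[->] [->]]].
have rw : reduced w by apply: path_sorted red.
split=> [/(act_readable red)[[i1 j1] /step_product[e f] /(IHw _ _ rw)]|].
  by rewrite !(act_step _ e, act_step _ f).
case=> /(act_readable red)[i1 e wi] /(act_readable red)[j1 f wj].
have /step_product ef := conj e f.
by rewrite (act_step _ ef); apply/(IHw _ _ rw).
Qed.

Lemma stabilizer_product i j :
  stabilizer fiber_product (i, j) = stabilizer E1 i `&` stabilizer E2 j.
Proof.
by apply/seteqP; split=> g /=; rewrite /stabilizer /= act_product ?(valP g).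
Qed.

End Product.

Lemma sval_inj (T : Type) (P : T -> Prop) (u v : {z : T | P z}) :
  sval u = sval v -> u = v.
Proof. by case: u v => u uP [v vP] /= uv; apply: eq_exist. Qed.

(** * The covering of a stabilizer and its core *)
Section Cover.
Variables (S : choiceType) (Q : eqType) (E : seq (Q * S * Q)) (q0 : Q).
Variable (G : subgroup (free S)).
Hypotheses (fE : folded E) (GE : G = stabilizer E q0 :> set (free S)).
Implicit Types (x y : letter S) (w l : seq (letter S)) (p q : Q) (g h : free S).
Implicit Types (C : coset_vertex G) (e : coset_vertex G * letter S).

Local Notation state g := (act E (q0, [::]) (val g)).
Local Notation backtrack_free := (fun x y : letter S => y != inv_letter x).

Lemma state_mul g h : state (g * h) = act E (state g) (val h).
Proof. exact: act_mul. Qed.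

Lemma state_word g w : state (g * free_word w) = act E (state g) w.
Proof. by rewrite state_mul act_reduce // proper_act. Qed.

Lemma state_letter g x : state (g * letter_val x) = move E (state g) x.
Proof. by rewrite letter_valE state_word. Qed.

Lemma state_eq_div g h : state g = state h -> subgroup_set G (g / h).
Proof.
move=> gh; rewrite GE; apply: etrans (state_mul g h^-1) _.
by rewrite gh act_free_inv.
Qed.

(** Vertices of the covering are the states reachable from the base state. *)
Lemma rcosetP g h : rcoset G g = rcoset G h <-> state g = state h.
Proof.
have [G1 GM _] := subgroup_groupP G.
have sub g1 h1 : state g1 = state h1 -> rcoset G g1 `<=` rcoset G h1.
  move=> /state_eq_div gh _ [a Ga <-]; exists (a * (g1 / h1)); first exact: GM.
  by rewrite -!mulgA mulVg mulg1.
split=> [gh|gh]; last by apply/seteqP; split; apply: sub.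
have : rcoset G g g by exists 1; rewrite ?mul1g.
by rewrite gh => -[k Gk <-]; move: Gk; rewrite GE state_mul /stabilizer /= => ->.
Qed.

(** A reduced path of the covering is read off as a word without backtracking that
moves the states accordingly. *)
Lemma walk_labels e s g : sval e.1 = rcoset G g ->
    path (fun e e' => `[< @follows (Defs.cover G) e e' >]) e s ->
  path backtrack_free e.2 (map snd s) /\
  exists2 h, sval (last e s).1 = rcoset G h &
             state h = act E (state g) (map snd (belast e s)).
Proof.
elim: s e g => [|f s IHs] e g eg /=; first by split=> //; exists g.
case/andP=> /asboolP[fe ef] fs.
have fg : sval f.1 = rcoset G (g * letter_val e.2).
  by rewrite [f.1]fe /= eg rcosetM.
have [-> [h hs hg]] := IHs f _ fg fs; split; last first.
  by exists h => //; rewrite hg state_letter.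
rewrite andbT; apply/eqP => fe2; apply: ef; case: f fe fe2 {fs fg hs hg IHs} => C y.
by rewrite /= => -> ->.
Qed.

Lemma circuit_step e (s : seq (edge (Defs.cover G))) g :
    circuit s -> List.In e s -> sval e.1 = rcoset G g ->
  exists2 q, state g = (q, [::]) & step E q e.2 <> None.
Proof.
move=> [_ cs] es eg; have [s1 [s2 sE]] := List.in_split _ _ es.
have : cycle (fun e e' => `[< @follows (Defs.cover G) e e' >]) (e :: s2 ++ s1).
  by rewrite -cat_cons -rot_size_cat rot_cycle -[s1 ++ _]sE.
move=> /= ce; have := walk_labels eg ce; rewrite last_rcons belast_rcons map_rcons.
case=> cyc [h /= hs hg].
have gg : act E (state g) (e.2 :: map snd (s2 ++ s1)) = state g.
  by rewrite -[LHS]hg; apply/rcosetP; rewrite -hs.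
have [] := act_loop fE (proper_act _ fE _) cyc gg; first by [].
by case: (state g) => q r /= -> ?; exists q.
Qed.

(** A circuit starting with the given edge, or with its reverse, is a loop as in
[act_loop]; hence the core of the covering lies in the finite graph. *)
Lemma core_edge_step e g : @core_edge (Defs.cover G) e -> sval e.1 = rcoset G g ->
  exists2 q, state g = (q, [::]) & step E q e.2 <> None.
Proof.
move=> [p cp [ep|ep]] eg; first exact: circuit_step cp ep eg.
have eg' : sval (cover_rev e).1 = rcoset G (g * letter_val e.2).
  by rewrite /= eg rcosetM.
have [q] := circuit_step cp ep eg'; rewrite state_letter /=.
case Eq: step => [q'|] // qE _.
have : move E (move E (state g) e.2) (inv_letter e.2) = (q', [::]).
  by rewrite qE /move /= Eq.
rewrite moveK ?proper_act // => gE; exists q' => //.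
by rewrite -[e.2]inv_letterK (stepV fE Eq).
Qed.

Lemma core_vertex_rep T B (C : coset_vertex G) : spanning E q0 T B ->
    @core_vertex (Defs.cover G) C ->
  exists2 q, reached E q0 T q & sval C = rcoset G (free_word (rep E q0 T q)).
Proof.
move=> sE [e ce eC]; have [g gC] := svalP C.
have eg : sval e.1 = rcoset G g by rewrite -gC -eC.
have [q gq] := core_edge_step ce eg.
case Ex: step => [q'|] // _; have rq := reached_step sE Ex.
exists q => //; rewrite gC; apply/rcosetP.
by rewrite gq /= act_reduce // act_rep.
Qed.

Definition exits q : seq (letter S) :=
  undup [seq x <- [seq (a.1.2, b) | a <- E, b <- [:: false; true]] |
           step E q x != None].

Lemma mem_exits q x : (x \in exits q) = (step E q x != None).
Proof.
rewrite mem_undup mem_filter andb_idr //.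
case Ex: (step E q x) => [q'|] // _; move/(stepP _ _ _ fE): Ex.
by rewrite /arc; case: x => s [] Es; apply/allpairsPdep;
   eexists; [exists true | exists false]; split; try exact: Es.
Qed.

Section Degree.
Variables (v : vertex (stallings G)) (g : free S) (q : Q).
Hypotheses (vg : sval (sval v) = rcoset G g) (gq : state g = (q, [::])).

Let star := [set e : edge (stallings G) | src e = v].
Let label (e : edge (stallings G)) : letter S := (sval e).2.

Lemma card_star : (star #= label @` star)%card.
Proof.
rewrite card_eq_sym; apply: inj_card_eq => e f /set_mem ev /set_mem fv ef.
have {}ev : (sval e).1 = sval v by rewrite -ev.
have {}fv : (sval f).1 = sval v by rewrite -fv.
apply: sval_inj; move: ev fv ef; rewrite /label.
by case: (sval e) (sval f) => [C x] [D y] /= -> -> ->.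
Qed.

Lemma card_exits : ([set` exits q] #= `I_(size (exits q)))%card.
Proof.
have -> : [set` exits q] = [set` [fset x in exits q]%fset].
  by apply/seteqP; split=> x /=; rewrite in_fset.
by apply/card_eq_fsetP; rewrite card_fseq undup_id ?undup_uniq.
Qed.

Lemma label_star : label @` star `<=` [set` exits q].
Proof.
move=> _ [e ev <-] /=; rewrite mem_exits.
have eg : sval (sval e).1 = rcoset G g by rewrite -vg -ev.
have [q'] := core_edge_step (svalP e) eg.
by rewrite gq => -[->] /eqP.
Qed.

(** Labels embed the star of a core vertex into the letters readable there. *)
Lemma degree_le n : degree_is v n -> n <= size (exits q).
Proof.
rewrite /degree_is -/star => vn.
rewrite -card_le_II -(card_le_eql vn) (card_le_eql card_star).
by rewrite -(card_le_eqr card_exits); apply: subset_card_le label_star.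
Qed.

Lemma degree_eq :
    (forall C x, sval C = rcoset G g -> step E q x <> None ->
      @core_edge (Defs.cover G) (C, x)) ->
  degree_is v (size (exits q)).
Proof.
move=> core_q; rewrite /degree_is -/star.
apply: card_eq_trans card_exits; apply: card_eq_trans card_star _.
suff -> : label @` star = [set` exits q] by [].
apply/seteqP; split; first exact: label_star.
move=> x; rewrite /= mem_exits => /eqP/(core_q _ _ vg) cx.
by exists (exist _ (sval v, x) cx) => //; apply: sval_inj.
Qed.

End Degree.

Fixpoint trail C l : seq (edge (Defs.cover G)) :=
  if l is x :: l' then (C, x) :: trail (coset_step C x) l' else [::].

Lemma path_trail C x l : path backtrack_free x l ->
  path (fun e e' => `[< @follows (Defs.cover G) e e' >]) (C, x)
    (trail (coset_step C x) l).
Proof.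
elim: l C x => //= y l IHl C x /andP[/eqP xy yl]; rewrite IHl // andbT.
by apply/asboolP; split=> // -[].
Qed.

Lemma trail_rcons C l x :
  trail C (rcons l x) = rcons (trail C l) (foldl (@coset_step S G) C l, x).
Proof. by elim: l C => //= y l IHl C; rewrite IHl. Qed.

Lemma trail_end C l g : sval C = rcoset G g ->
  sval (foldl (@coset_step S G) C l) = rcoset G (g * free_word l).
Proof.
elim: l C g => [|x l IHl] C g Cg /=.
  by rewrite (_ : free_word [::] = 1) // mulg1.
rewrite (IHl _ (g * letter_val x)) /= ?Cg ?rcosetM //.
by rewrite letter_valE -mulgA -free_word_cat.
Qed.

Lemma circuit_trail C l g : sval C = rcoset G g -> l <> [::] ->
  cyclically_reduced l -> act E (state g) l = state g -> circuit (trail C l).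
Proof.
case: l => // x l Cg _ cyc loop; split=> //=.
suff <- : trail (coset_step C x) (rcons l x) = rcons (trail (coset_step C x) l) (C, x).
  exact: path_trail.
rewrite trail_rcons; congr (rcons _ (_, _)); apply: sval_inj.
rewrite -[foldl _ _ _]/(foldl (@coset_step S G) C (x :: l)) (trail_end _ Cg) Cg.
by apply/rcosetP; rewrite state_word.
Qed.

Fixpoint arcs_along q l : seq (Q * letter S) :=
  if l is x :: l' then
    (q, x) :: (if step E q x is Some q' then arcs_along q' l' else [::])
  else [::].

Lemma in_trail C C' l g h p q y : sval C = rcoset G g -> state g = (q, [::]) ->
    sval C' = rcoset G h -> state h = (p, [::]) -> (p, y) \in arcs_along q l ->
  List.In ((C', y) : edge (Defs.cover G)) (trail C l).
Proof.
elim: l C g q => //= x l IHl C g q Cg gq C'h hp.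
rewrite inE => /orP[/eqP[pq ->]|yl]; [left|right].
  congr pair; apply: sval_inj; rewrite Cg C'h; apply/rcosetP.
  by rewrite gq hp pq.
case Ex: (step E q x) yl => [q'|] // yl.
apply: (IHl _ (g * letter_val x) q' _ _ C'h hp yl).
  by rewrite /= Cg rcosetM.
by rewrite state_letter gq /move /= Ex.
Qed.

(** A closed cyclically reduced path at the base vertex that runs through every
arc, in one direction or the other, puts the whole graph into the core. *)
Definition traversed l : bool :=
  [&& l != [::], cyclically_reduced l, act E (q0, [::]) l == (q0, [::]) &
    all (fun a => ((a.1.1, (a.1.2, false)) \in arcs_along q0 l) ||
                  ((a.2, (a.1.2, true)) \in arcs_along q0 l)) E].

Lemma traversed_core l C x g q : traversed l ->
    sval C = rcoset G g -> state g = (q, [::]) -> step E q x <> None ->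
  @core_edge (Defs.cover G) (C, x).
Proof.
case/and4P=> /eqP l0 cyc /eqP loop /allP allE Cg gq.
case Ex: (step E q x) => [q'|] // _.
have C1P : exists h, rcoset G 1 = rcoset G h by exists 1.
pose C1 : coset_vertex G := exist _ (rcoset G 1) C1P.
have C1E : sval C1 = rcoset G 1 by [].
exists (trail C1 l); first exact: circuit_trail C1E _ _ _.
have : ((q, x) \in arcs_along q0 l) || ((q', inv_letter x) \in arcs_along q0 l).
  move/(stepP _ _ _ fE): Ex; rewrite /arc; case: x => s [] /allE //=.
  by rewrite orbC.
case/orP=> xl; [left|right]; first exact: in_trail C1E erefl Cg gq xl.
have C'g : sval (coset_step C x) = rcoset G (g * letter_val x).
  by rewrite /= Cg rcosetM.
apply: (in_trail C1E erefl C'g _ xl).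
by rewrite state_letter gq /move /= Ex.
Qed.

End Cover.

(** * Double cosets *)

Lemma loop_state (S : choiceType) (Q : eqType) (E : seq (Q * S * Q)) (q0 : Q)
    (g c : free S) x l :
    folded E -> stabilizer E q0 g -> g * c = c * free_word (x :: l) ->
    cyclically_reduced (x :: l) ->
  exists2 q, act E (q0, [::]) (val c) = (q, [::]) & step E q x <> None.
Proof.
move=> fE gE gc cyc.
have loop : act E (act E (q0, [::]) (val c)) (x :: l) = act E (q0, [::]) (val c).
  rewrite -[LHS](state_word q0 fE c) -gc act_mul //.
  by move: gE; rewrite /stabilizer /= => ->.
have [] := act_loop fE (proper_act _ fE _) cyc loop; first by [].
by case: (act E _ (val c)) => q s /= -> ?; exists q.
Qed.

Lemma double_coset_mul (G : groupType) (H K : subgroup G) h k :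
    subgroup_set H h -> subgroup_set K k ->
  double_coset H (h * k) K = [set x * y | x in H & y in K].
Proof.
have [[_ HM HV] [_ KM KV]] := (subgroup_groupP H, subgroup_groupP K).
move=> Hh Kk; apply/seteqP; split=> _ [x Hx [y Ky <-]].
  exists (x * h); first exact: HM.
  by exists (k * y); [exact: KM | rewrite !mulgA].
exists (x * h^-1); first by apply: HM => //; apply: HV.
exists (k^-1 * y); first by apply: KM => //; apply: KV.
by rewrite !mulgA mulgVK mulgK.
Qed.

Section DoubleCosets.
Variables (S : choiceType) (Q1 Q2 : eqType).
Variables (E1 : seq (Q1 * S * Q1)) (E2 : seq (Q2 * S * Q2)) (i : Q1) (j : Q2).
Variables (H K : subgroup (free S)) (T B : seq (seq (letter S))).
Hypotheses (fE1 : folded E1) (fE2 : folded E2).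
Hypotheses (HE : H = stabilizer E1 i :> set (free S)).
Hypotheses (KE : K = stabilizer E2 j :> set (free S)).
Hypothesis (sE : spanning (fiber_product E1 E2) (i, j) T B).

(** It suffices that the fiber product has no arc outside the component of its
base pair, which is what a spanning tree of it witnesses. *)
Lemma meets_conjugate_factor t : meets_conjugate H K t ->
  exists2 h, subgroup_set H h & exists2 k, subgroup_set K k & t = h * k.
Proof.
move=> tHK; apply: contrapT => not_mul; apply: tHK; apply/seteqP.
have [[H1 _ _] [K1 KM KV]] := (subgroup_groupP H, subgroup_groupP K).
split=> [g [Hg [k Kk kg]]|_ ->]; last first.
  by split=> //; exists 1; rewrite ?mulg1 ?mulgV.
rewrite /= -kg; apply: contrapT => k1; case: not_mul.
have [||l [l0 cyc] [c kE]] := @cyclic_reduction _ (val k); first exact: valP.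
  by move=> kE; apply: k1; rewrite (_ : k = 1) ?mulg1 ?mulgV //; apply: val_inj.
case: l => // x l in l0 cyc kE *.
(* K c is fixed by l, and so is H t c. *)
have kc : k * free_word c = free_word c * free_word (x :: l).
  by rewrite -[k]free_wordK kE !free_word_cat free_word_inv !mulgA mulgVK.
have gc : g * (t * free_word c) = t * free_word c * free_word (x :: l).
  by rewrite -kg !mulgA mulgVK -!mulgA kc.
rewrite HE in Hg; have KEk := Kk; rewrite KE in KEk.
have [i1 ti] := loop_state fE1 Hg gc cyc.
have [j1 cj] := loop_state fE2 KEk kc cyc.
case Ej: (step E2 j1 x) => [j'|] // _; case Ei: (step E1 i1 x) => [i'|] // _.
have Eij : step (fiber_product E1 E2) (i1, j1) x = Some (i', j').
  by apply/(step_product fE1 fE2).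
have := act_rep (reached_step sE Eij).
set r := rep _ _ _ _; rewrite -act_reduce ?folded_product // => /act_product.
case=> // [|ri rj]; first exact: reduced_reduce.
exists (t * free_word c / free_word r).
  by apply: (state_eq_div fE1 HE); rewrite ti.
exists (free_word r / free_word c); first by apply: (state_eq_div fE2 KE); rewrite cj.
by rewrite mulgA mulgVK mulgK.
Qed.

End DoubleCosets.

(** * The subgroups of the example *)

Local Notation pos s := (s, false).
Local Notation neg s := (s, true).

Definition lasso_a2 : seq (letter generator) :=
  [:: pos B1; pos B2; pos A2; neg B2; neg B1].
Definition lasso_a3 : seq (letter generator) :=
  [:: pos A1; pos B1; pos B3; pos A3; neg B3; neg B1; neg A1].

Definition cycle_basis n : seq (seq (letter generator)) :=
  [:: lasso_a2; nseq n (pos A1); lasso_a3].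

(** The cycle has the vertices 0, ..., n - 1; the lasso ending in the loop a2 goes
through n and n + 1, the one ending in a3 through n + 2 and n + 3. *)
Definition cycle_graph n : seq (nat * generator * nat) :=
  ([seq (i, A1, i.+1 %% n) | i <- iota 0 n] ++
   [:: (0, B1, n); (n, B2, n.+1); (n.+1, A2, n.+1);
       (1, B1, n.+2); (n.+2, B3, n.+3); (n.+3, A3, n.+3)])%N.

Definition cycle_tree n : seq (seq (letter generator)) :=
  [seq nseq i (pos A1) | i <- iota 0 n] ++
  [:: [:: pos B1]; [:: pos B1; pos B2];
      [:: pos A1; pos B1]; [:: pos A1; pos B1; pos B3]].

(** H and K are the cases n = 2 and n = 3, and their intersection is n = 6. *)
Definition cycle_group n : subgroup (free generator) :=
  generated [set b1 * b2 * a2 * b2^-1 * b1^-1; a1 ^+ n;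
                 (a1 * b1 * b3) * a3 * (a1 * b1 * b3)^-1].

Lemma word_group3 (S : choiceType) (u v w : seq (letter S)) :
  word_group [:: u; v; w] =
  generated [set free_word u; free_word v; free_word w].
Proof.
congr generated; apply/seteqP; split=> [_ [t] /= + <-|_ /= [[]|] ->].
- by rewrite !inE => /or3P[] /eqP->; [left; left|left; right|right].
- by exists u; rewrite // inE eqxx.
- by exists v; rewrite // !inE eqxx orbT.
- by exists w; rewrite // !inE eqxx !orbT.
Qed.

Lemma cycle_groupE n : cycle_group n = word_group (cycle_basis n).
Proof.
rewrite /cycle_group word_group3; congr (generated [set _; _; _]).
elim: n => // n IHn.
by rewrite expgS IHn -[nseq n.+1 _]/([:: pos A1] ++ nseq n (pos A1)) free_word_cat.
Qed.

(** The two lassos share their arc b1, from 0 to 1. *)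
Definition join_graph : seq (nat * generator * nat) :=
  [:: (0, A1, 0); (0, B1, 1); (1, B2, 2); (2, A2, 2); (1, B3, 3); (3, A3, 3)]%N.

Definition join_tree : seq (seq (letter generator)) :=
  [:: [::]; [:: pos B1]; [:: pos B1; pos B2]; [:: pos B1; pos B3]].

Definition join_basis : seq (seq (letter generator)) :=
  [:: lasso_a2; [:: pos A1]; [:: pos B1; pos B3; pos A3; neg B3; neg B1]].

(** It runs around both lassos and then along the loop a1. *)
Definition join_circuit : seq (letter generator) :=
  [:: pos B1; pos B2; pos A2; neg B2; pos B3; pos A3; neg B3; neg B1; pos A1].

(** Walking along a1 from (0, 0) visits the pairs (k mod 2, k mod 3). The lassos
leave at k = 0 and k = 1. At k = 3 and k = 4 both coordinates lie in {0, 1} but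
differ, so that an arc b1 leaves there too, to a dead end. *)
Definition meet_tree : seq (seq (letter generator)) :=
  cycle_tree 6 ++
  [:: rcons (nseq 3 (pos A1)) (pos B1); rcons (nseq 4 (pos A1)) (pos B1)].

Local Notation H2 := (cycle_group 2).
Local Notation K3 := (cycle_group 3).

Lemma spanning_H2 : spanning (cycle_graph 2) 0%N (cycle_tree 2) (cycle_basis 2).
Proof. by vm_compute. Qed.

Lemma spanning_K3 : spanning (cycle_graph 3) 0%N (cycle_tree 3) (cycle_basis 3).
Proof. by vm_compute. Qed.

Lemma spanning_meet : spanning (fiber_product (cycle_graph 2) (cycle_graph 3))
  (0%N, 0%N) meet_tree (cycle_basis 6).
Proof. by vm_compute. Qed.

Lemma spanning_join : spanning join_graph 0%N join_tree join_basis.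
Proof. by vm_compute. Qed.

Lemma traversed_join : traversed join_graph 0%N join_circuit.
Proof. by vm_compute. Qed.

Lemma H2_stabilizer : H2 = stabilizer (cycle_graph 2) 0%N :> set (free generator).
Proof. by rewrite cycle_groupE (spanning_generates spanning_H2). Qed.

Lemma K3_stabilizer : K3 = stabilizer (cycle_graph 3) 0%N :> set (free generator).
Proof. by rewrite cycle_groupE (spanning_generates spanning_K3). Qed.

Lemma meet_H2_K3 : H2 `&` K3 = cycle_group 6.
Proof.
rewrite (cycle_groupE 6) (spanning_generates spanning_meet).
have [[fH _ _ _] [fK _ _ _]] := (and4P spanning_H2, and4P spanning_K3).
by rewrite stabilizer_product // H2_stabilizer K3_stabilizer.
Qed.

(** The join contains a1 = a1^3 a1^-2, and then the a3-lasso conjugated by a1. *)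
Lemma join_H2_K3 : join H2 K3 = stabilizer join_graph 0%N :> set (free generator).
Proof.
rewrite -(spanning_generates spanning_join); apply/seteqP; split.
  apply: generated_sub; rewrite (spanning_generates spanning_join) !cycle_groupE.
  have [fJ _ _ _] := and4P spanning_join.
  move=> g []; move: g;
    apply: (@generated_sub _ _ (Subgroup (stabilizer_group_set 0 fJ)));
    move=> _ [w /= + <-]; rewrite !inE => /or3P[] /eqP->;
    by apply/eqP; vm_compute.
have [_ JM JV] := subgroup_groupP (join H2 K3).
have Hw w : act (cycle_graph 2) (0%N, [::]) (reduce w) == (0%N, [::]) ->
    subgroup_set (join H2 K3) (free_word w).
  by move=> /eqP wE; apply: join_subl; rewrite H2_stabilizer.
have Kw w : act (cycle_graph 3) (0%N, [::]) (reduce w) == (0%N, [::]) ->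
    subgroup_set (join H2 K3) (free_word w).
  by move=> /eqP wE; apply: join_subr; rewrite K3_stabilizer.
have Ja : subgroup_set (join H2 K3) (free_word [:: pos A1]).
  rewrite -[free_word _](mulgK (free_word [:: pos A1; pos A1])).
  apply: JM; last by apply: JV; apply: Hw; vm_compute.
  by rewrite -free_word_cat; apply: Kw; vm_compute.
apply: generated_sub => _ [w /= + <-].
rewrite !inE => /or3P[] /eqP-> //; first by apply: Hw; vm_compute.
have -> : free_word [:: pos B1; pos B3; pos A3; neg B3; neg B1] =
    (free_word [:: pos A1])^-1 * free_word lasso_a3 * free_word [:: pos A1].
  by apply: val_inj; vm_compute.
apply: (JM) => //; apply: JM; first exact: JV.
by apply: Hw; vm_compute.
Qed.

(** One circuit passes through all arcs, so every letter readable at a vertex counts,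
and there are three of them at each of the four vertices. *)
Lemma degree_join (v : vertex (stallings (join H2 K3))) : degree_is v 3.
Proof.
have [fJ _ _ _] := and4P spanning_join.
have [q] := core_vertex_rep fJ join_H2_K3 spanning_join (svalP v).
set r := rep _ _ _ _ => rq vr.
have gq : act join_graph (0%N, [::]) (val (free_word r)) = (q, [::]).
  by rewrite /= act_reduce // act_rep.
have exits3 : size (exits join_graph q) = 3.
  by case/hasP: rq => w; rewrite !inE => /or4P[] /eqP-> /eqP[<-]; vm_compute.
have := degree_eq fJ join_H2_K3 vr gq; rewrite exits3; apply=> C x Cg qx.
exact: (traversed_core fJ join_H2_K3 traversed_join Cg gq qx).
Qed.

Lemma meets_conjugate_one : meets_conjugate H2 K3 1.
Proof.
move=> HK1; have : (H2 `&` conjugate 1 K3) (free_word lasso_a2).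
  split; first by rewrite H2_stabilizer; vm_compute.
  exists (free_word lasso_a2); last by rewrite invg1 mulg1 mul1g.
  by rewrite K3_stabilizer; vm_compute.
by rewrite HK1 => /(congr1 val).
Qed.

Lemma meets_conjugate_trivial t : meets_conjugate H2 K3 t ->
  double_coset H2 t K3 = [set h * k | h in H2 & k in K3].
Proof.
have [[fH _ _ _] [fK _ _ _]] := (and4P spanning_H2, and4P spanning_K3).
case/(meets_conjugate_factor fH fK H2_stabilizer K3_stabilizer spanning_meet)
  => h Hh [k Kk ->].
exact: double_coset_mul.
Qed.

(** The words of the tree enumerate the vertices of the cycle graph, and the arc b1
of the join graph ends at its vertex 1. *)
Definition pinched n : bool :=
  all (fun w => (act join_graph (0%N, [::]) w == (1%N, [::])) ==>
    (size (exits (cycle_graph n) (act (cycle_graph n) (0%N, [::]) w).1) <= 2)%N)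
   (cycle_tree n).

Lemma pinched_degree n (G : subgroup (free generator)) (GJ : G `<=` join H2 K3)
    (u : vertex (stallings G)) :
    spanning (cycle_graph n) 0%N (cycle_tree n) (cycle_basis n) ->
    G = stabilizer (cycle_graph n) 0%N :> set (free generator) -> pinched n ->
    sval (sval (vmap (stallings_map GJ) u)) =
      rcoset (join H2 K3) (free_word [:: pos B1]) ->
  ~ degree_is u 3.
Proof.
move=> sE GE /allP pn uv u3; have [fE _ _ _] := and4P sE.
have [fJ _ _ _] := and4P spanning_join.
have [q rq uq] := core_vertex_rep fE GE sE (svalP u).
have gq : act (cycle_graph n) (0%N, [::])
    (val (free_word (rep (cycle_graph n) 0%N (cycle_tree n) q))) = (q, [::]).
  by rewrite /= act_reduce // act_rep.
have := degree_le fE GE uq gq u3; apply/negP; rewrite -ltnNge ltnS.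
have wT : rep (cycle_graph n) 0%N (cycle_tree n) q \in cycle_tree n.
  by rewrite mem_nth // -has_find.
have := implyP (pn _ wT); rewrite (act_rep rq); apply; apply/eqP.
move: uv; rewrite /= uq coset_prod_rcoset // => /(rcosetP fJ join_H2_K3).
by rewrite /= act_reduce // => ->.
Qed.

(** The end of the arc b1 lies on the core, since the arc b2 leaving it does. *)
Lemma branch_vertex : exists v : vertex (stallings (join H2 K3)),
  sval (sval v) = rcoset (join H2 K3) (free_word [:: pos B1]).
Proof.
have [fJ _ _ _] := and4P spanning_join.
have CP : exists w,
    rcoset (join H2 K3) (free_word [:: pos B1]) = rcoset (join H2 K3) w.
  by exists (free_word [:: pos B1]).
pose C : coset_vertex (join H2 K3) := exist _ _ CP.
have C1 : act join_graph (0%N, [::]) (val (free_word [:: pos B1])) = (1%N, [::]).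
  by vm_compute.
have B2C : step join_graph 1%N (pos B2) <> None by vm_compute.
have cC : @core_vertex (Defs.cover (join H2 K3)) C.
  exists (C, pos B2) => //.
  exact: (traversed_core fJ join_H2_K3 traversed_join (C := C) erefl C1 B2C).
by exists (exist _ C cC).
Qed.

Lemma cycle_group_fg n : finitely_generated (cycle_group n).
Proof. exact: ex_intro2 (finite_set3 _ _ _) erefl. Qed.

Theorem mainTheorem3 :
  let H := generated [set b1 * b2 * a2 * b2^-1 * b1^-1;
                          a1 ^+ 2;
                          (a1 * b1 * b3) * a3 * (a1 * b1 * b3)^-1] in
  let K := generated [set b1 * b2 * a2 * b2^-1 * b1^-1;
                          a1 ^+ 3;
                          (a1 * b1 * b3) * a3 * (a1 * b1 * b3)^-1] in
  [/\ [set D | exists2 t, D = double_coset H t K & meets_conjugate H K t] =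
        [set [set h * k | h in H & k in K]]
      /\ double_coset_reps H K [set 1],
      H `&` K = generated [set b1 * b2 * a2 * b2^-1 * b1^-1;
                               a1 ^+ 6;
                               (a1 * b1 * b3) * a3 * (a1 * b1 * b3)^-1],
      forall v : vertex (stallings (join H K)), degree_is v 3,
      exists v : vertex (stallings (join H K)),
        [/\ degree_is v 3,
            forall u : vertex (stallings H),
              vmap (to_joinl H K) u = v -> ~ degree_is u 3
          & forall u : vertex (stallings K),
              vmap (to_joinr H K) u = v -> ~ degree_is u 3]
    & ~ (forall (S : choiceType) (H' K' : subgroup (free S)),
           finitely_generated H' -> finitely_generated K' ->
           (forall v : vertex (stallings (join H' K')),
              degree_is v 3 \/ degree_is v 2) ->
           forall v : vertex (stallings (join H' K')), degree_is v 3 ->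
             (exists2 u : vertex (stallings H'),
                vmap (to_joinl H' K') u = v & degree_is u 3) \/
             (exists2 u : vertex (stallings K'),
                vmap (to_joinr H' K') u = v & degree_is u 3))].
Proof.
have [v vE] := branch_vertex.
have vH (u : vertex (stallings H2)) : vmap (to_joinl H2 K3) u = v -> ~ degree_is u 3.
  move=> uv; apply: (pinched_degree (GJ := @join_subl _ H2 K3)
    spanning_H2 H2_stabilizer) => //.
  by rewrite -vE -uv.
have vK (u : vertex (stallings K3)) : vmap (to_joinr H2 K3) u = v -> ~ degree_is u 3.
  move=> uv; apply: (pinched_degree (GJ := @join_subr _ H2 K3)
    spanning_K3 K3_stabilizer) => //.
  by rewrite -vE -uv.
have HK1 : double_coset H2 1 K3 = [set h * k | h in H2 & k in K3].
  exact: meets_conjugate_trivial meets_conjugate_one.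
move=> H' K'; split.
- split.
    apply/seteqP; split=> D /=; first by move=> [t -> /meets_conjugate_trivial].
    by move=> ->; exists 1; [exact: (esym HK1) | exact: meets_conjugate_one].
  split=> [_ -> |t tHK]; first exact: meets_conjugate_one.
  exists 1; split=> [|s [-> //]]; split=> //.
  by rewrite HK1 (meets_conjugate_trivial tHK).
- exact: meet_H2_K3.
- exact: degree_join.
- by exists v; split; [exact: degree_join | exact: vH | exact: vK].
move=> /(_ _ H2 K3 (cycle_group_fg 2) (cycle_group_fg 3)) branch.
have [|[u uv u3]|[u uv u3]] := branch _ v (degree_join v).
- by left; exact: degree_join.
- exact: vH uv u3.
- exact: vK uv u3.
Qed.
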